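(* Let $N>1$ and $1\le n_{0} \le \dotso \le n_{K} \le N$ be real numbers, $\chi(x,\lambda)=\#\{k:|x-n_k|\le\lambda\}$, $a_k\in\mathbb{C}$, and $S(t)=\sum_{k=0}^{K}a_k n_k^{-\mathrm{i} t}$. Let $T_0\in\mathbb{R}$, $T>0$, $\delta>0$ and $\mathcal{T} \subseteq [T_{0}+\delta/2, T_{0}+T-\delta/2]$ be a set of $\delta$-well-spaced points, in the sense that $|t-t'|\ge \delta$ for $t, t'\in\mathcal{T}$, $t\neq t'$. Then, for any $\eta>0$, \[ \sum_{t\in\mathcal{T}}|S(t)|^{2} \ll \Bigl(T+ \frac{1}{\eta}\Bigr)\Bigl(\log N + \frac{1}{\delta}\Bigr)\sum_{k=0}^{K}\chi(n_{k}, \eta N)|a_{k}|^{2}. \] *)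

(* Defs.v *)
From mathcomp Require Export all_boot all_order all_algebra.
From mathcomp Require Export all_classical all_reals all_analysis.
From mathcomp Require Export complex.

Set Implicit Arguments.
Unset Strict Implicit.
Unset Printing Implicit Defensive.

Import Order.TTheory GRing.Theory Num.Theory.

Local Open Scope classical_set_scope.
Local Open Scope ring_scope.
Local Open Scope complex_scope.

Definition cexp (R : realType) (z : R[i]) : R[i] :=
  (expR (complex.Re z))%:C * (cos (complex.Im z) +i* sin (complex.Im z)).

(* Principal value; only meaningful for a positive base [x]. *)
Definition cpow (R : realType) (x : R) (z : R[i]) : R[i] :=
  cexp (z * (ln x)%:C).

(* [`|z|] on [R[i]] is again complex-valued; this is the modulus in [R]. *)
Definition cmod (R : realType) (z : R[i]) : R := Normc.normc z.

(* Counts indices, so repeated frequencies count with multiplicity. *)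
Definition chi (R : realType) (K : nat) (n : 'I_K.+1 -> R) (x lambda : R)
  : nat := #|[pred k : 'I_K.+1 | `|x - n k| <= lambda]|.

Definition dirichlet_sum (R : realType) (K : nat) (n : 'I_K.+1 -> R)
    (a : 'I_K.+1 -> R[i]) (t : R) : R[i] :=
  \sum_(k < K.+1) a k * cpow (n k) (- ('i%C * t%:C)).

Definition well_spaced (R : realType) (delta : R) (P : set R) : Prop :=
  forall t t' : R, P t -> P t' -> t <> t' -> delta <= `|t - t'|.

(* Main.v *)
Require Import Defs.
From mathcomp Require Import finmap ring lra.

(* Put [lam k = ln (n k)], [L = ln N] and [X = (T + 1/eta) (L + 1/delta)].
   Sort the frequencies [lam k] into cells of length [h <= min(eta, 1/T)] and
   the points [t - T0] into cells of length [d <= min(delta, 1/L)], where [h d =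
   2 pi / M] and [M] is an integer of size [O(X)]. If [lam = c h + u] and [t -
   T0 = m d + v] with [0 <= u < h] and [0 <= v < d], then [lam (t - T0) = 2 pi c
   m / M + u m d + lam v]. The first term is the phase of the discrete Fourier
   transform of length [M]: by orthogonality its quadratic form is bounded by
   [M] times the sum of the [|a k|^2] weighted with the cell occupancies, and
   these are at most [chi] because [|ln x - ln y| <= eta] forces [|x - y| <= eta
   N]. The other two terms are products of a bounded function of [t] and a
   bounded function of [k], and such a factor [exp (i x y)] changes the bound
   only by a constant. *)

Set Implicit Arguments.
Unset Strict Implicit.
Unset Printing Implicit Defensive.

Import Order.TTheory GRing.Theory Num.Theory.
Import numFieldNormedType.Exports.

Local Open Scope classical_set_scope.
Local Open Scope ring_scope.
Local Open Scope complex_scope.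

(** * The complex modulus with values in the reals *)

Section Modulus.
Variable R : realType.
Implicit Types z w : R[i].

Lemma cmod_ge0 z : 0 <= cmod z.
Proof. by case: z => a b; exact: sqrtr_ge0. Qed.

Lemma cmodM z w : cmod (z * w) = cmod z * cmod w.
Proof. exact: Normc.normcM. Qed.

Lemma cmodD z w : cmod (z + w) <= cmod z + cmod w.
Proof. exact: le_normcD. Qed.

Lemma cmodX z n : cmod (z ^+ n) = cmod z ^+ n.
Proof.
elim: n => [|n IHn]; first by rewrite !expr0; exact: Normc.normc1.
by rewrite !exprS cmodM IHn.
Qed.

Lemma cmod_sum (I : Type) (r : seq I) (P : pred I) (F : I -> R[i]) :
  cmod (\sum_(i <- r | P i) F i) <= \sum_(i <- r | P i) cmod (F i).
Proof.
elim/big_ind2: _ => [|x1 x2 y1 y2 h1 h2|//]; first by rewrite /cmod Normc.normc0.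
exact: le_trans (cmodD _ _) (lerD h1 h2).
Qed.

Lemma cmod_real (x : R) : cmod x%:C = `|x|.
Proof. by rewrite /cmod /= expr0n addr0 sqrtr_sqr. Qed.

Lemma cmod_conj z : cmod z^*%C = cmod z.
Proof. by case: z => a b; rewrite /cmod /= sqrrN. Qed.

Lemma cmod_i : cmod ('i%C : R[i]) = 1.
Proof. by rewrite /cmod /= expr0n add0r expr1n sqrtr1. Qed.

Lemma sqr_cmod z : (cmod z ^+ 2)%:C = z * z^*%C.
Proof.
case: z => a b; rewrite /cmod /= sqr_sqrtr ?addr_ge0 ?sqr_ge0//.
by apply/eqP; rewrite eq_complex /=; apply/andP; split; apply/eqP; ring.
Qed.

(* [(p + q)^2 <= (1 + s) p^2 + (1 + 1/s) q^2] with [q = s * cmod w]. *)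
Lemma sqr_cmodD z w (s : R) : 0 < s ->
  cmod (z + s%:C * w) ^+ 2 <=
  (1 + s) * cmod z ^+ 2 + (s + s ^+ 2) * cmod w ^+ 2.
Proof.
move=> s0; have : cmod (z + s%:C * w) <= cmod z + s * cmod w.
  by rewrite (le_trans (cmodD _ _))// cmodM cmod_real gtr0_norm.
rewrite -ler_sqr ?nnegrE ?addr_ge0 ?mulr_ge0 ?cmod_ge0 ?(ltW s0)//.
move/le_trans; apply; move: (cmod z) (cmod w) => q p.
suff : 0 <= s * (q - p) ^+ 2 by nra.
by rewrite mulr_ge0 ?sqr_ge0// ltW.
Qed.

Lemma cmod_subX z w (B : R) n : cmod z <= B -> cmod w <= B ->
  cmod (z ^+ n.+1 - w ^+ n.+1) <= n.+1%:R * B ^+ n * cmod (z - w).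
Proof.
move=> zB wB; rewrite subrXX cmodM mulrC ler_wpM2r ?cmod_ge0//.
apply: le_trans (cmod_sum _ _ _) _.
have -> : n.+1%:R * B ^+ n = \sum_(i < n.+1) B ^+ n.
  by rewrite sumr_const card_ord mulr_natl.
apply: ler_sum => i _; rewrite cmodM !cmodX.
have -> : B ^+ n = B ^+ (n - i) * B ^+ i by rewrite -exprD subnK// -ltnS.
by apply: ler_pM; rewrite ?exprn_ge0 ?cmod_ge0// lerXn2r// nnegrE ?cmod_ge0//;
  exact: le_trans (cmod_ge0 z) zB.
Qed.

End Modulus.

(** * The exponential of an imaginary number and its approximation by powers *)

Section Cis.
Variable R : realType.
Implicit Types x y : R.

Definition cis x : R[i] := cos x +i* sin x.

Lemma cisD x y : cis (x + y) = cis x * cis y.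
Proof.
rewrite /cis cosD sinD; apply/eqP; rewrite eq_complex /=.
by apply/andP; split; apply/eqP; ring.
Qed.

Lemma cis0 : cis 0 = 1.
Proof. by rewrite /cis cos0 sin0. Qed.

Lemma cisMn x n : cis (n%:R * x) = cis x ^+ n.
Proof.
elim: n => [|n IHn]; first by rewrite mul0r cis0 expr0.
by rewrite -natr1 mulrDl mul1r cisD IHn exprSr.
Qed.

Lemma conj_cis x : (cis x)^*%C = cis (- x).
Proof. by rewrite /cis cosN sinN. Qed.

Lemma cmod_cis x : cmod (cis x) = 1.
Proof. by rewrite /cmod /= cos2Dsin2 sqrtr1. Qed.

Lemma cis2pi : cis (2 * pi) = 1.
Proof. by rewrite /cis mulr_natl cos2pi sin2pi. Qed.

(** By the double angle formula, [cos x = 1] forces [sin (x / 2) = 0], although [x / 2] lies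
    strictly between 0 and [pi]. *)
Lemma cis_neq1 x : 0 < x < 2 * pi -> cis x != 1.
Proof.
move=> /andP[x0 x2]; apply/eqP => -[+ _].
have -> : x = (x / 2) *+ 2 by rewrite -mulr_natr divfK.
rewrite cos_mulr2n => h.
have : 0 < sin (x / 2) by apply: sin_gt0_pi; rewrite divr_gt0//= ltr_pdivrMr// mulrC.
have := cos2Dsin2 (x / 2).
nra.
Qed.

(** First of three mean value estimates on [[0, x]], each using the previous one to bound the
    derivative. The constants are not sharp; only the orders [x], [x ^+ 2], [x ^+ 3] matter. *)
Lemma norm_sin_le x : 0 <= x -> `|sin x| <= x.
Proof.
move=> x0.
have cf : {within `[0, x], continuous (@sin R)}.
  by apply: continuous_subspaceT => y; exact: continuous_sin.
have [c _] := @MVT_segment R sin cos 0 x x0 (fun y _ => is_derive_sin y) cf.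
rewrite sin0 !subr0 => ->; rewrite normrM (ger0_norm x0) ler_piMl//; exact: cos_max.
Qed.

Lemma norm_1Bcos_le x : 0 <= x -> `|cos x - 1| <= x ^+ 2.
Proof.
move=> x0.
have cf : {within `[0, x], continuous (@cos R)}.
  by apply: continuous_subspaceT => y; exact: continuous_cos.
have [c] := @MVT_segment R cos (fun z => - sin z) 0 x x0 (fun y _ => is_derive_cos y) cf.
rewrite in_itv/= => /andP[c0 cx].
rewrite cos0 !subr0 => ->; rewrite normrM normrN (ger0_norm x0) expr2 ler_wpM2r//.
exact: le_trans (norm_sin_le c0) cx.
Qed.

Lemma norm_sinB_le x : 0 <= x -> `|sin x - x| <= x ^+ 3.
Proof.
move=> x0.
have cf : {within `[0, x], continuous (@sin R)}.
  by apply: continuous_subspaceT => y; exact: continuous_sin.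
have [c] := @MVT_segment R sin cos 0 x x0 (fun y _ => is_derive_sin y) cf.
rewrite in_itv/= => /andP[c0 cx].
rewrite sin0 !subr0 => ->; rewrite -{2}(mul1r x) -mulrBl normrM (ger0_norm x0).
rewrite exprSr ler_wpM2r//; apply: le_trans (norm_1Bcos_le c0) _.
by rewrite ler_sqr.
Qed.

Lemma cmod_cisB_le x : `|x| <= 1 -> cmod (cis x - (1 + 'i%C * x%:C)) <= 2 * x ^+ 2.
Proof.
have cisBE y : cis y - (1 + 'i%C * y%:C) = (cos y - 1)%:C + 'i%C * (sin y - y)%:C.
  apply/eqP; rewrite eq_complex /=; apply/andP; split; apply/eqP; ring.
wlog x0 : x / 0 <= x => [hw x1|].
  have [|x0] := leP 0 x; first by move=> x0; exact: hw.
  have := hw (- x); rewrite oppr_ge0 normrN sqrrN => /(_ (ltW x0) x1).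
  rewrite -cmod_conj; congr (cmod _ <= _); rewrite /cis cosN sinN.
  by apply/eqP; rewrite eq_complex /=; apply/andP; split; apply/eqP; ring.
rewrite (ger0_norm x0) => x1; rewrite cisBE (le_trans (cmodD _ _))//.
rewrite cmodM cmod_i mul1r !cmod_real mulr_natl mulr2n lerD//.
  exact: norm_1Bcos_le.
apply: le_trans (norm_sinB_le x0) _.
by rewrite exprSr ler_piMr ?sqr_ge0.
Qed.

Lemma expr_1Dinv_le n : (1 + n.+1%:R^-1) ^+ n.+1 <= expR 1 :> R.
Proof.
apply: (@le_trans _ _ (expR n.+1%:R^-1 ^+ n.+1)).
  by rewrite lerXn2r ?nnegrE ?expR_ge0 ?addr_ge0// expR_ge1Dx.
by rewrite -expRM_natl divff.
Qed.

Lemma cmod_1Di_le n x : `|x| <= 1 ->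
  cmod (1 + 'i%C * (x / n.+1%:R)%:C) <= 1 + n.+1%:R^-1.
Proof.
move=> x1; rewrite (le_trans (cmodD _ _))// cmodM cmod_i mul1r cmod_real.
rewrite {1}/cmod Normc.normc1 lerD2l normrM normfV (ger0_norm (ler0n _ _)).
by rewrite ler_piMl.
Qed.

(** [cis x] is the power [n.+1] of [cis (x / n.+1%:R)]. The two bases differ by a term of order
    [n.+1%:R ^- 2], and [cmod_subX] multiplies this by [n.+1] and by a power that stays below
    [expR 1]. *)
Lemma cis_approx n x : `|x| <= 1 ->
  cmod (cis x - (1 + 'i%C * (x / n.+1%:R)%:C) ^+ n.+1) <= 2 * expR 1 / n.+1%:R.
Proof.
move=> x1; have n0 : 0 < n.+1%:R :> R by [].
have {1}-> : x = n.+1%:R * (x / n.+1%:R) by rewrite mulrC divfK.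
rewrite cisMn.
have B1 : 1 <= 1 + n.+1%:R^-1 :> R by rewrite lerDl invr_ge0.
have := @cmod_subX R (cis (x / n.+1%:R)) _ _ n _ (cmod_1Di_le n x1).
rewrite cmod_cis => /(_ B1)/le_trans; apply.
have xn : `|x / n.+1%:R| <= 1.
  rewrite normrM normfV (ger0_norm (ltW n0)) ler_pdivrMr// mul1r.
  by rewrite (le_trans x1)// ler1n.
have h := cmod_cisB_le xn.
apply: (@le_trans _ _ (n.+1%:R * expR 1 * (2 * (x / n.+1%:R) ^+ 2))).
  apply: ler_pM; rewrite ?cmod_ge0 ?mulr_ge0 ?exprn_ge0 ?addr_ge0//.
  rewrite ler_wpM2l//; apply: le_trans (expr_1Dinv_le n).
  exact: ler_weXn2l.
rewrite [leLHS](_ : _ = (2 * expR 1 / n.+1%:R) * x ^+ 2); last by field; rewrite gt_eqF.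
rewrite ler_piMr ?divr_ge0 ?mulr_ge0 ?expR_ge0//.
by rewrite -[x ^+ 2]ger0_norm ?sqr_ge0// normrX exprn_ile1.
Qed.

End Cis.

Arguments cis : simpl never.

(** * Quadratic form bounds and multipliers [cis (x i * y j)] *)

Section Multiplier.
Variables (R : realType) (I J : finType).
Implicit Types (A : I -> J -> R[i]) (w : J -> R) (a : J -> R[i]).

(** A large sieve inequality for an arbitrary matrix. The weight sits on the columns, so that it can
    carry the local counts of frequencies. *)
Definition l2bound A w := forall a,
  \sum_i cmod (\sum_j A i j * a j) ^+ 2 <= \sum_j w j * cmod (a j) ^+ 2.

Variables (x : I -> R) (y : J -> R).
Hypotheses (x1 : forall i, `|x i| <= 1) (y1 : forall j, `|y j| <= 1).

(** The perturbation is the original form applied to [y j * a j], then scaled by ['i * x i]; neither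
    operation increases the bound. The costs add up to [(1 + s) + (s + s ^+ 2) = (1 + s) ^+ 2]. *)
Lemma l2bound_affine A w (s : R) : 0 < s -> (forall j, 0 <= w j) ->
  l2bound A w ->
  l2bound (fun i j => A i j * (1 + 'i%C * (x i * y j * s)%:C))
          (fun j => (1 + s) ^+ 2 * w j).
Proof.
move=> s0 w0 Aw a.
pose S b i := \sum_j A i j * b j.
pose ya j := (y j)%:C * a j.
have sumE i : \sum_j A i j * (1 + 'i%C * (x i * y j * s)%:C) * a j =
    S a i + s%:C * ('i%C * (x i)%:C * S ya i).
  rewrite !mulr_sumr -big_split /=; apply: eq_bigr => j _.
  by rewrite /ya !rmorphM /=; ring.
under eq_bigr do rewrite sumE.
apply: (@le_trans _ _ ((1 + s) * (\sum_i cmod (S a i) ^+ 2) +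
    (s + s ^+ 2) * (\sum_i cmod (S ya i) ^+ 2))).
  rewrite !mulr_sumr -big_split /=; apply: ler_sum => i _.
  apply: le_trans (sqr_cmodD _ _ s0) _; rewrite lerD2l ler_wpM2l//.
    by rewrite addr_ge0 ?sqr_ge0 ?ltW.
  rewrite 2!cmodM cmod_i mul1r cmod_real.
  by rewrite lerXn2r ?nnegrE ?mulr_ge0 ?cmod_ge0// ler_piMl ?cmod_ge0.
have Hya : \sum_j w j * cmod (ya j) ^+ 2 <= \sum_j w j * cmod (a j) ^+ 2.
  apply: ler_sum => j _; rewrite ler_wpM2l// cmodM cmod_real.
  by rewrite lerXn2r ?nnegrE ?mulr_ge0 ?cmod_ge0// ler_piMl ?cmod_ge0.
have -> : \sum_j (1 + s) ^+ 2 * w j * cmod (a j) ^+ 2 =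
    (1 + s) * (\sum_j w j * cmod (a j) ^+ 2) +
    (s + s ^+ 2) * (\sum_j w j * cmod (a j) ^+ 2).
  by rewrite -mulrDl mulr_sumr; apply: eq_bigr => j _; ring.
apply: lerD; rewrite ler_wpM2l ?addr_ge0 ?sqr_ge0 ?(ltW s0)//; first exact: Aw.
exact: le_trans (Aw _) Hya.
Qed.

Lemma l2bound_affineX A w (s : R) n : 0 < s -> (forall j, 0 <= w j) ->
  l2bound A w ->
  l2bound (fun i j => A i j * (1 + 'i%C * (x i * y j * s)%:C) ^+ n)
          (fun j => ((1 + s) ^+ 2) ^+ n * w j).
Proof.
move=> s0 w0 Aw; elim: n => [|n IHn].
  move=> a; have := Aw a; congr (_ <= _); last by apply: eq_bigr => j _; rewrite expr0 mul1r.
  by apply: eq_bigr => i _; under [in RHS]eq_bigr do rewrite expr0 mulr1.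
have w'0 j : 0 <= ((1 + s) ^+ 2) ^+ n * w j.
  by apply: mulr_ge0; rewrite // exprn_ge0// sqr_ge0.
move=> a; have := l2bound_affine s0 w'0 IHn a; congr (_ <= _).
  apply: eq_bigr => i _; congr (cmod _ ^+ 2); apply: eq_bigr => j _.
  by rewrite exprSr mulrA.
by apply: eq_bigr => j _; rewrite [_ ^+ n.+1]exprS !mulrA.
Qed.

(* [cis (x i * y j)] is the limit of [(1 + 'i (x i * y j) / n) ^+ n], and
   each of the [n] factors costs [(1 + n^-1) ^+ 2] by [l2bound_affine]. *)
Lemma l2bound_cis A w : (forall j, 0 <= w j) -> l2bound A w ->
  l2bound (fun i j => A i j * cis (x i * y j)) (fun j => expR 2 * w j).
Proof.
move=> w0 Aw a.
pose D i := \sum_j cmod (A i j * a j).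
have D0 i : 0 <= D i by apply: sumr_ge0 => j _; exact: cmod_ge0.
have xy1 i j : `|x i * y j| <= 1 by rewrite normrM mulr_ile1.
pose F n i := \sum_j A i j * (1 + 'i%C * (x i * y j / n.+1%:R)%:C) ^+ n.+1 * a j.
pose G i := \sum_j A i j * cis (x i * y j) * a j.
pose e : R := expR 1.
have e0 : 0 <= e by exact: expR_ge0.
have FD n i : cmod (F n i) <= e * D i.
  rewrite mulr_sumr (le_trans (cmod_sum _ _ _))//; apply: ler_sum => j _.
  rewrite mulrAC [leLHS]cmodM [leLHS]mulrC ler_wpM2r ?cmod_ge0// cmodX.
  apply: le_trans (expr_1Dinv_le _ n).
  by rewrite lerXn2r ?nnegrE ?cmod_ge0 ?addr_ge0// cmod_1Di_le.
have GF n i : cmod (G i) <= cmod (F n i) + 2 * e / n.+1%:R * D i.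
  have -> : G i = F n i + (G i - F n i) by rewrite addrC subrK.
  apply: le_trans (cmodD _ _) _; rewrite lerD2l -sumrB mulr_sumr.
  apply: le_trans (cmod_sum _ _ _) _; apply: ler_sum => j _.
  rewrite -mulrBl -mulrBr mulrAC [leLHS]cmodM [leLHS]mulrC ler_wpM2r ?cmod_ge0//.
  exact: cis_approx.
(* Squaring [GF] gives a cross term and a square, each at most [4 * (e * D i) ^+ 2 / n.+1%:R], by
   [FD] and [n.+1%:R^-1 <= 1] respectively. *)
have GF2 n i : cmod (G i) ^+ 2 <= cmod (F n i) ^+ 2 + 8 * (e * D i) ^+ 2 / n.+1%:R.
  have n0 : 0 < n.+1%:R^-1 :> R by rewrite invr_gt0.
  have n1 : n.+1%:R^-1 <= 1 :> R by rewrite invf_le1// ler1n.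
  have := GF n i; have := FD n i.
  have := cmod_ge0 (F n i); have := cmod_ge0 (G i); have := mulr_ge0 e0 (D0 i).
  have -> : 2 * e / n.+1%:R * D i = 2 * (e * D i) / n.+1%:R by ring.
  move: (cmod (F n i)) (cmod (G i)) (e * D i) (n.+1%:R^-1) n0 n1 => f g d r.
  move=> r0 r1 d0 g0 f0 fd gf.
  have : g ^+ 2 <= (f + 2 * d * r) ^+ 2.
    by rewrite lerXn2r// nnegrE addr_ge0 ?mulr_ge0// ltW.
  move/le_trans; apply.
  have : f * (d * r) <= d * (d * r) by rewrite ler_wpM2r// mulr_ge0// ltW.
  have : d ^+ 2 * r * r <= d ^+ 2 * r * 1.
    by rewrite ler_wpM2l// mulr_ge0 ?sqr_ge0// ltW.
  nra.
pose W := \sum_j w j * cmod (a j) ^+ 2.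
have W0 : 0 <= W by apply: sumr_ge0 => j _; rewrite mulr_ge0 ?sqr_ge0.
have FW n : \sum_i cmod (F n i) ^+ 2 <= expR 2 * W.
  have s0 : 0 < n.+1%:R^-1 :> R by rewrite invr_gt0.
  apply: le_trans (l2bound_affineX n.+1 s0 w0 Aw a) _.
  rewrite mulr_sumr; apply: ler_sum => j _; rewrite mulrA.
  rewrite ler_wpM2r ?sqr_ge0// ler_wpM2r// exprAC.
  have -> : 2 = 2%:R * 1 :> R by rewrite mulr1.
  rewrite expRM_natl lerXn2r ?nnegrE ?expR_ge0 ?exprn_ge0 ?addr_ge0//.
  exact: expr_1Dinv_le.
have -> : \sum_j expR 2 * w j * cmod (a j) ^+ 2 = expR 2 * W.
  by rewrite mulr_sumr; apply: eq_bigr => j _; rewrite mulrA.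
pose E := \sum_i 8 * (e * D i) ^+ 2.
have E0 : 0 <= E by apply: sumr_ge0 => i _; rewrite mulr_ge0 ?sqr_ge0.
apply/ler_addgt0Pr => eps eps0.
(* This [n] makes the total error [E / n.+1%:R] at most [eps]. *)
pose n := Num.truncn (E / eps).
apply: (@le_trans _ _ (\sum_i cmod (F n i) ^+ 2 + E / n.+1%:R)).
  by rewrite mulr_suml -big_split /=; apply: ler_sum => i _; exact: GF2.
apply: lerD => //; rewrite ler_pdivrMr// mulrC -ler_pdivrMr//.
by rewrite ltW// truncnS_gt.
Qed.

End Multiplier.

(** Selecting distinct rows only drops nonnegative terms on the left. *)
Lemma l2bound_inj (R : realType) (I I' J : finType) (f : I' -> I)
    (A : I -> J -> R[i]) (w : J -> R) :
  injective f -> l2bound A w -> l2bound (fun i => A (f i)) w.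
Proof.
move=> f_inj Aw a; apply: le_trans (Aw a).
rewrite -(big_imset (fun i => cmod (\sum_j A i j * a j) ^+ 2) (in2W f_inj)) /=.
rewrite [leRHS](bigID [in f @: predT]) /= lerDl.
by apply: sumr_ge0 => i _; exact: sqr_ge0.
Qed.

(** * The discrete Fourier transform of length [M] *)

Section Fourier.
Variables (R : realType) (M : nat).

Lemma cis_2piM n : cis (n%:R * (2 * pi)) = 1 :> R[i].
Proof. by rewrite cisMn cis2pi expr1n. Qed.

(** A geometric sum over the powers of an [M]-th root of unity other than 1. Conjugation exchanges
    [c] and [d], so the angle may be taken in the range of [cis_neq1]. *)
Lemma sum_cis_eq0 (c d : 'I_M) : c != d ->
  \sum_(m < M) cis (m%:R * (2 * pi / M%:R * (c%:R - d%:R))) = 0 :> R[i].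
Proof.
have M0 : 0 < M%:R :> R by rewrite ltr0n (leq_ltn_trans _ (ltn_ord c)).
wlog ltdc : c d / (d < c)%N => [hw neq_cd|_].
  have [ltcd|ltdc|/ord_inj cd] := ltngtP c d; [|exact: hw|by rewrite cd eqxx in neq_cd].
  have /(congr1 (fun z => z^*%C)) := hw d c ltcd (ltac:(by rewrite eq_sym)).
  rewrite rmorph_sum conjc0 => h; rewrite -[RHS]h; apply: eq_bigr => m _.
  by rewrite [RHS]conj_cis; congr cis; ring.
set t := 2 * pi / M%:R * _.
have z1 : cis t ^+ M = 1.
  rewrite -cisMn.
  have -> : M%:R * t = (c - d)%:R * (2 * pi).
    by rewrite /t natrB ?(ltnW ltdc)//; field; rewrite gt_eqF.
  exact: cis_2piM.
have z_neq1 : cis t != 1.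
  apply: cis_neq1; have p0 := pi_gt0 R.
  have d0 : 0 < c%:R - d%:R :> R by rewrite subr_gt0 ltr_nat.
  rewrite /t !mulr_gt0 ?invr_gt0//= -mulrA gtr_pMr ?mulr_gt0//.
  rewrite mulrC ltr_pdivrMr// mul1r.
  by rewrite (@le_lt_trans _ _ c%:R) ?ltr_nat// lerBlDr lerDl.
under eq_bigr do rewrite cisMn.
apply/eqP; have /eqP : (cis t - 1) * \sum_(m < M) cis t ^+ m = 0.
  by rewrite -subrX1 z1 subrr.
by rewrite mulf_eq0 subr_eq0 (negbTE z_neq1).
Qed.

(** After expanding the square, orthogonality keeps only the pairs with [c k = c j]. Bounding each
    product by the mean of the two squares and using the symmetry of this relation gives the
    occupancy weight. *)
Lemma l2bound_fourier (J : finType) (c : J -> 'I_M) :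
  l2bound (fun (m : 'I_M) j => cis (- (2 * pi / M%:R * m%:R * (c j)%:R)) : R[i])
          (fun j => M%:R * #|[pred k | c k == c j]|%:R).
Proof.
move=> a; set X := (leLHS).
have X0 : 0 <= X by apply: sumr_ge0 => m _; exact: sqr_ge0.
have XE : X%:C = \sum_j \sum_(k | c k == c j) M%:R%:C * (a j * (a k)^*%C).
  have conjM (u v : R[i]) : (u * v)^*%C = u^*%C * v^*%C by exact: (rmorphM (@conjc R)).
  have conj_sum (F : J -> R[i]) : (\sum_j F j)^*%C = \sum_j (F j)^*%C.
    exact: (rmorph_sum (@conjc R)).
  rewrite rmorph_sum /=.
  under eq_bigr => m _.
    rewrite sqr_cmod conj_sum mulr_suml.
    under eq_bigr do rewrite mulr_sumr.
    over.
  rewrite exchange_big /=; apply: eq_bigr => j _.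
  rewrite exchange_big /= [RHS]big_mkcond; apply: eq_bigr => k _.
  transitivity (\sum_(m < M) a j * (a k)^*%C *
      cis (m%:R * (2 * pi / M%:R * ((c k)%:R - (c j)%:R)))).
    apply: eq_bigr => m _; rewrite conjM conj_cis mulrACA -cisD mulrC.
    by congr (_ * cis _); ring.
  rewrite -mulr_sumr; case: eqVneq => [->|neq_kj]; last by rewrite sum_cis_eq0 ?mulr0.
  under eq_bigr do rewrite subrr !mulr0 cis0.
  by rewrite sumr_const card_ord mulrC rmorph_nat.
rewrite -(ger0_norm X0) -cmod_real XE.
apply: (@le_trans _ _ (\sum_j \sum_(k | c k == c j)
    M%:R * ((cmod (a j) ^+ 2 + cmod (a k) ^+ 2) / 2))).
  apply: le_trans (cmod_sum _ _ _) _; apply: ler_sum => j _.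
  apply: le_trans (cmod_sum _ _ _) _; apply: ler_sum => k _.
  rewrite 2!cmodM cmod_real cmod_conj ger0_norm// ler_wpM2l//.
  by have := sqr_ge0 (cmod (a j) - cmod (a k)); lra.
set Y := (leRHS).
have Y1 : Y = \sum_j \sum_(k | c k == c j) M%:R * cmod (a j) ^+ 2.
  by apply: eq_bigr => j _; rewrite sumr_const -[RHS]mulr_natr [LHS]mulrAC.
have Y2 : Y = \sum_j \sum_(k | c k == c j) M%:R * cmod (a k) ^+ 2.
  rewrite Y1 (exchange_big_dep xpredT)//=; apply: eq_bigr => j _.
  by apply: eq_bigl => k; rewrite eq_sym.
have -> : Y = (Y + Y) / 2 by field.
rewrite {1}Y1 Y2 -big_split mulr_suml /=; apply: ler_sum => j _.
rewrite -big_split mulr_suml /=; apply: ler_sum => k _.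
by rewrite -mulrDr mulrA.
Qed.

End Fourier.

(** * Cells of length [h] on the half-line *)

Section Cells.
Variables (R : realType) (h : R).
Hypothesis h0 : 0 < h.
Implicit Types x y : R.

Definition cell x : nat := Num.truncn (x / h).

Lemma cell_le x : 0 <= x -> (cell x)%:R * h <= x.
Proof. by move=> x0; rewrite -ler_pdivlMr// truncn_le divr_ge0// ltW. Qed.

Lemma cell_gt x : x < (cell x)%:R * h + h.
Proof. by rewrite -[X in _ + X]mul1r -mulrDl -ltr_pdivrMr// natr1 truncnS_gt. Qed.

Lemma cell_lt x n : 0 <= x -> x < n%:R * h -> (cell x < n)%N.
Proof.
by move=> x0 xn; rewrite -(ltr_nat R) -(ltr_pM2r h0) (le_lt_trans (cell_le x0)).
Qed.

Lemma eq_cell_dist x y : 0 <= x -> 0 <= y -> cell x = cell y -> `|x - y| < h.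
Proof.
move=> x0 y0 xy; rewrite ltr_norml.
have := cell_le x0; have := cell_le y0; have := cell_gt x; have := cell_gt y.
by rewrite xy; move: (_ * h) => z; lra.
Qed.

Lemma norm_cell_rem x : 0 <= x -> `|(x - (cell x)%:R * h) / h| <= 1.
Proof.
move=> x0; rewrite normrM normfV (gtr0_norm h0) ler_pdivrMr// mul1r.
by rewrite ger0_norm ?subr_ge0 ?cell_le// lerBlDl ltW// cell_gt.
Qed.

End Cells.

(** * The large sieve for real frequencies *)

Section LargeSieve.
Variable R : realType.

(* [h] and [d] are the lengths of the cells into which the frequencies [lam
   j] and the points [t i] are sorted. *)
Lemma l2bound_exp_sum (I J : finType) (t : I -> R) (lam : J -> R) (w : J -> R)
    (h d T L : R) (M : nat) :
  0 < h -> 0 < d -> (0 < M)%N -> M%:R * (h * d) = 2 * pi ->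
  h * T <= 1 -> d * L <= 1 ->
  (forall i, 0 <= t i <= T) -> (forall j, 0 <= lam j <= L) ->
  (forall i i', `|t i - t i'| < d -> i = i') ->
  (forall j, #|[pred k | `|lam j - lam k| < h]|%:R <= w j) ->
  l2bound (fun i j => cis (- (lam j * t i))) (fun j => expR 4 * M%:R * w j).
Proof.
move=> h0 d0 M0 Mhd hT dL tT lamL t_inj lamw.
have t0 i : 0 <= t i by have /andP[] := tT i.
have l0 j : 0 <= lam j by have /andP[] := lamL j.
have MR0 : M%:R != 0 :> R by rewrite pnatr_eq0 -lt0n.
have twopi : 1 < 2 * pi :> R by have := pi_ge2 R; lra.
(* The [M] cells of length [d] cover [[0, T]], because [h * T <= 1 < 2 * pi = h * (M%:R * d)]; the
   frequencies are treated alike. *)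
have tM i : (cell d (t i) < M)%N.
  apply: cell_lt => //; rewrite -(ltr_pM2l h0) mulrCA Mhd.
  by apply: le_lt_trans twopi; apply: le_trans hT; rewrite ler_pM2l//; have /andP[] := tT i.
have lM j : (cell h (lam j) < M)%N.
  apply: cell_lt => //; rewrite -(ltr_pM2l d0).
  have -> : d * (M%:R * h) = 2 * pi by rewrite -Mhd; ring.
  by apply: le_lt_trans twopi; apply: le_trans dL; rewrite ler_pM2l//; have /andP[] := lamL j.
pose m i := Ordinal (tM i); pose c j := Ordinal (lM j).
have m_inj : injective m.
  by move=> i i' /(congr1 val)/= mm; apply: t_inj; exact: eq_cell_dist mm.
have fourier := l2bound_inj m_inj (@l2bound_fourier R M J c).
(* [xt i * yt j] and [xl i * yl j] are the two phases left over from the Fourier phase. The factors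
   [h] and [d] are distributed so that all four functions are bounded by 1. *)
pose xt i := - ((cell d (t i))%:R * d * h).
pose yt j := (lam j - (cell h (lam j))%:R * h) / h.
pose xl i := (t i - (cell d (t i))%:R * d) / d.
pose yl j := - (d * lam j).
have xt1 i : `|xt i| <= 1.
  rewrite normrN ger0_norm ?mulr_ge0 ?(ltW h0) ?(ltW d0)//.
  apply: le_trans hT; rewrite mulrC ler_pM2l//.
  by apply: le_trans (cell_le d0 (t0 i)) _; have /andP[] := tT i.
have yt1 j : `|yt j| <= 1 by exact: norm_cell_rem.
have xl1 i : `|xl i| <= 1 by exact: norm_cell_rem.
have yl1 j : `|yl j| <= 1.
  rewrite normrN ger0_norm ?mulr_ge0 ?(ltW d0)//.
  by apply: le_trans dL; rewrite ler_pM2l//; have /andP[] := lamL j.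
have w1 j : 0 <= M%:R * #|[pred k | c k == c j]|%:R :> R by rewrite mulr_ge0.
have w2 j : 0 <= expR 2 * (M%:R * #|[pred k | c k == c j]|%:R) :> R.
  by rewrite mulr_ge0 ?expR_ge0.
(* Each of the two multipliers costs [expR 2], whence [expR 4]. *)
have main := l2bound_cis xl1 yl1 w2 (l2bound_cis xt1 yt1 w1 fourier).
move=> a; apply: le_trans (le_trans _ (main a)) _.
  rewrite le_eqVlt; apply/orP; left; apply/eqP.
  apply: eq_bigr => i _; congr (cmod _ ^+ 2); apply: eq_bigr => j _.
  rewrite -!cisD; congr (cis _ * _).
  have -> : 2 * pi / M%:R = h * d by rewrite -Mhd mulrAC divff// mul1r.
  by rewrite /xt /yt /xl /yl /=; field; rewrite !gt_eqF.
apply: ler_sum => j _; rewrite ler_wpM2r ?sqr_ge0//.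
have -> : expR 4 = expR 2 * expR 2 :> R by rewrite -expRD; congr expR; ring.
rewrite !mulrA ler_wpM2l ?mulr_ge0 ?expR_ge0//.
apply: le_trans (lamw j); rewrite ler_nat; apply: subset_leq_card.
apply/fintype.subsetP => k; rewrite !inE => /eqP/(congr1 val)/= ckj.
exact: eq_cell_dist (esym ckj).
Qed.

End LargeSieve.

(** * From logarithmic frequencies to Dirichlet sums *)

Lemma distr_le_ln (R : realType) (N x y : R) : 0 < x <= N -> 0 < y <= N ->
  `|x - y| <= `|ln x - ln y| * N.
Proof.
wlog lexy : x y / x <= y => [hw xN yN|].
  have [lexy|/ltW leyx] := leP x y; first exact: hw.
  by rewrite distrC (distrC (ln x)); exact: hw.
move=> /andP[x0 xN] /andP[y0 yN].
have lnxy : ln x <= ln y by rewrite ler_ln.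
rewrite !ler0_norm ?subr_le0// !opprB.
have := expR_ge1Dx (ln x - ln y).
rewrite expRB !lnK// ler_pdivlMr// => h.
have : (ln y - ln x) * y <= (ln y - ln x) * N by rewrite ler_wpM2l// subr_ge0.
nra.
Qed.

Lemma cpow_cis (R : realType) (x t : R) : cpow x (- ('i%C * t%:C)) = cis (- (ln x * t)).
Proof.
rewrite /cpow /cexp /=.
rewrite !(mul0r, mulr0, mul1r, subr0, addr0, oppr0, sub0r, add0r) expR0.
rewrite mul1r /cis; congr (cos _ +i* sin _); ring.
Qed.

Theorem theorem2p2 (R : realType) :
  exists C : R, 0 < C /\
    forall (N : R) (K : nat) (n : 'I_K.+1 -> R) (a : 'I_K.+1 -> R[i])
      (T0 T delta : R) (P : set R) (eta : R),
    1 < N ->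
    (forall k : 'I_K.+1, 1 <= n k <= N) ->
    (forall j k : 'I_K.+1, (j <= k)%N -> n j <= n k) ->
    0 < T -> 0 < delta ->
    P `<=` [set t | T0 + delta / 2 <= t <= T0 + T - delta / 2] ->
    well_spaced delta P ->
    0 < eta ->
    (\esum_(t in P) (cmod (dirichlet_sum n a t) ^+ 2)%:E
     <= (C * ((T + eta^-1) * (ln N + delta^-1) *
         \sum_(k < K.+1) (chi n (n k) (eta * N))%:R * cmod (a k) ^+ 2))%:E)%E.
Proof.
have pi0 := pi_gt0 R.
have C0 : 0 < expR 4 * (2 * pi + 1) :> R.
  by rewrite mulr_gt0 ?expR_gt0// addr_gt0// mulr_gt0.
(* [expR 4] comes from [l2bound_exp_sum], and [2 * pi + 1] from [M%:R <= 2 * pi * X + 1 <= (2 * pi +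
   1) * X]. *)
exists (expR 4 * (2 * pi + 1)); split => //.
move=> N K n a T0 T delta P eta N1 nN _ T_gt0 delta0 Psub Psp eta0.
have N0 : 0 < N by exact: lt_trans N1.
have n0 k : 0 < n k by have /andP[n1 _] := nN k; exact: lt_le_trans n1.
have L0 : 0 < ln N by exact: ln_gt0.
have T'0 : 0 < T + eta^-1 by rewrite addr_gt0// invr_gt0.
have L'0 : 0 < ln N + delta^-1 by rewrite addr_gt0// invr_gt0.
pose d := (ln N + delta^-1)^-1.
have d0 : 0 < d by rewrite invr_gt0.
pose X := (T + eta^-1) * (ln N + delta^-1).
have X0 : 0 < X by rewrite mulr_gt0.
(* Replacing [2 * pi * X] by a larger integer makes [h * d] exactly [2 * pi / M%:R] and only
   shortens [h], which stays below [(T + eta^-1)^-1]. *)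
pose M := (Num.truncn (2 * pi * X)).+1.
have MX : 2 * pi * X <= M%:R by rewrite ltW// truncnS_gt.
have MR0 : 0 < M%:R :> R by [].
pose h := 2 * pi / (M%:R * d).
have h0 : 0 < h by rewrite divr_gt0 ?mulr_gt0.
have h_le : h <= (T + eta^-1)^-1.
  have hd : (T + eta^-1)^-1 * (M%:R * d) = M%:R / X by rewrite mulrCA -invfM.
  by rewrite ler_pdivrMr ?mulr_gt0// hd ler_pdivlMr.
have hT : h * T <= 1.
  apply: le_trans (ler_pM _ _ h_le (lexx T)) _; rewrite ?(ltW h0) ?(ltW T_gt0)//.
  by rewrite mulrC ler_pdivrMr// mul1r lerDl invr_ge0 ltW.
have heta : h <= eta.
  apply: le_trans h_le _; rewrite -[leRHS]invrK lef_pV2 ?posrE ?invr_gt0//.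
  by rewrite lerDr ltW.
have dL : d * ln N <= 1 by rewrite mulrC ler_pdivrMr// mul1r lerDl invr_ge0 ltW.
have ddelta : d <= delta.
  by rewrite /d -[leRHS]invrK lef_pV2 ?posrE ?invr_gt0// lerDr ltW.
apply: ge_ereal_sup => _ [F [finF FP] <-].
have [->|/set0P[t1 Ft1]] := eqVneq F set0.
  rewrite fsbig_set0 lee_fin; apply: mulr_ge0; first exact: ltW.
  by apply: mulr_ge0; [exact: ltW|apply: sumr_ge0 => k _; rewrite mulr_ge0 ?sqr_ge0].
(* A single point already forces the interval containing [P] to be nonempty. Hence
   [X >= T / delta >= 1], which absorbs the rounding error in [M]. *)
have Tdelta : delta <= T by have /andP := Psub _ (FP _ Ft1); lra.
have X1 : 1 <= X.
  apply: (@le_trans _ _ (T * delta^-1)); first by rewrite ler_pdivlMr// mul1r.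
  by apply: ler_pM; rewrite ?invr_ge0 ?(ltW T_gt0) ?(ltW delta0)// ?lerDl ?lerDr// ltW// invr_gt0.
rewrite fsbig_finite//= sumEFin lee_fin.
rewrite big_seq_fsetE /=.
have inF (i : fset_set F) : F (val i) by have := valP i; rewrite in_fset_set// => /set_mem.
pose lam k := ln (n k).
pose t (i : fset_set F) := val i - T0.
pose w k : R := (chi n (n k) (eta * N))%:R.
have tT i : 0 <= t i <= T.
  by have /andP := Psub _ (FP _ (inF i)); rewrite /t; lra.
have lamL k : 0 <= lam k <= ln N.
  by have /andP[n1 nkN] := nN k; rewrite ln_ge0//= ler_ln// posrE.
have t_inj i i' : `|t i - t i'| < d -> i = i'.
  rewrite /t opprB addrA subrK => tt'; apply/val_inj/eqP/negPn/negP => /eqP neq.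
  have := Psp _ _ (FP _ (inF i)) (FP _ (inF i')) neq.
  by rewrite leNgt (lt_le_trans tt').
have lamw k : #|[pred j | `|lam k - lam j| < h]|%:R <= w k.
  rewrite ler_nat; apply: subset_leq_card; apply/fintype.subsetP => j.
  rewrite !inE => lam_h.
  have nkN i : 0 < n i <= N by rewrite n0; have /andP[] := nN i.
  apply: le_trans (distr_le_ln (nkN k) (nkN j)) _.
  by rewrite ler_pM2r// ltW// (lt_le_trans lam_h).
have Mhd : M%:R * (h * d) = 2 * pi by rewrite /h; field; rewrite !gt_eqF.
(* Translation by [T0] multiplies each coefficient by a number of modulus 1. *)
have sumE i : dirichlet_sum n a (val i) =
    \sum_k cis (- (lam k * t i)) * (a k * cis (- (lam k * T0))).
  apply: eq_bigr => k _; rewrite cpow_cis mulrCA -cisD; congr (_ * cis _).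
  by rewrite /t /lam; ring.
under eq_bigr do rewrite sumE.
apply: le_trans (l2bound_exp_sum h0 d0 (ltn0Sn _) Mhd hT dL tT lamL t_inj lamw _) _.
apply: (@le_trans _ _ (expR 4 * (M%:R * \sum_k w k * cmod (a k) ^+ 2))).
  rewrite !mulr_sumr; apply: ler_sum => k _.
  by rewrite cmodM cmod_cis mulr1 !mulrA.
rewrite -mulrA ler_pM2l ?expR_gt0// [leRHS]mulrA ler_wpM2r//.
  by apply: sumr_ge0 => k _; rewrite mulr_ge0 ?sqr_ge0.
have : M%:R <= 2 * pi * X + 1.
  by rewrite /M -[leLHS]natr1 lerD2r truncn_le mulr_ge0// ltW// mulr_gt0.
by rewrite -/X; nra.
Qed.
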